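(* Let $d\geq 2$ be an integer and let $A=\mathbb{C}[x_0,\ldots,x_m]/I$ be an artinian algebra, with $I=(f_0,\ldots,f_m)$ generated by a regular sequence of homogeneous forms of degree $d$. Then for general $z\in A_1$ the multiplication map $\mu_z\colon A_{d-1}\longrightarrow A_d$, $P\mapsto zP$, is injective.
   Context: $A_k$ denotes the degree $k$ homogeneous part of the graded algebra $A$. Since $d\ge 2$, $A_1$ is identified with the space of linear forms $\langle x_0,\ldots,x_m\rangle$. ''For general $z\in A_1$'' means: for all $z$ in some nonempty Zariski open subset of $A_1$.
   Formalization: The formal theorem adds the assumption m ≥ 2; for m = 0 (dim A_{d-1} = 1, A_d = 0) and for m = 1 (dim A_{d-1} = d > d − 1 = dim A_d) the map is never injective, so the claim is false there. *)

(* Defs.v *)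
From HB Require Import structures.
From mathcomp Require Import all_boot all_order all_algebra.
From mathcomp Require Import boolp classical_sets reals.
From mathcomp Require Import complex mpoly.

Set Implicit Arguments.
Unset Strict Implicit.
Unset Printing Implicit Defensive.
Import GRing.Theory.
Local Open Scope ring_scope.
Local Open Scope classical_set_scope.
Local Open Scope quotient_scope.

Section Ideals.
Variable R : comPzRingType.

Definition is_ideal (J : set R) : Prop :=
  [/\ J 0, (forall a b, J a -> J b -> J (a + b)) & (forall r a, J a -> J (r * a))].

Definition artinian : Prop :=
  forall J : nat -> set R,
    (forall k, is_ideal (J k)) -> (forall k, J k.+1 `<=` J k) ->
    exists N, forall k, (N <= k)%N -> J k = J N.

End Ideals.

Section QuotientByGenerators.
Variables (R : comNzRingType) (s : seq R).

Definition ideal_gen : {pred R} :=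
  fun p => `[< exists c : 'I_(size s) -> R, p = \sum_i c i * s`_i >].

Fact ideal_gen_zmod_closed : zmod_closed ideal_gen.
Proof.
split=> [|p q /asboolP[c ->] /asboolP[e ->]]; apply/asboolP.
  by exists (fun=> 0); rewrite big1 // => i _; rewrite mul0r.
exists (fun i => c i - e i); rewrite -sumrB.
by apply: eq_bigr => i _; rewrite mulrBl.
Qed.

HB.instance Definition _ := GRing.isZmodClosed.Build R ideal_gen
  ideal_gen_zmod_closed.

Fact ideal_genMl a p : p \in ideal_gen -> a * p \in ideal_gen.
Proof.
move=> /asboolP[c ->]; apply/asboolP; exists (fun i => a * c i).
by rewrite mulr_sumr; apply: eq_bigr => i _; rewrite mulrA.
Qed.

(* [{ideal_quot _}] carries a ring structure in the library only for proper
   ideals; the ring structure is rebuilt here without properness, so that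
   [rquot s] makes sense for every [s]. *)
Definition rquot : Type := {ideal_quot ideal_gen}.

HB.instance Definition _ := GRing.Zmodule.on rquot.
HB.instance Definition _ := EqQuotient.on rquot.
HB.instance Definition _ := ZmodQuotient.on rquot.

Definition rquot_one : rquot := lift_cst rquot 1.
Definition rquot_mul := lift_op2 rquot *%R.

Fact pi_rquot_mul : {morph \pi_rquot : x y / x * y >-> rquot_mul x y}.
Proof.
move=> x y; unlock rquot_mul; apply/eqP.
rewrite -(Quotient.idealrBE ideal_gen).
set x' := repr _; set y' := repr _.
have hx : x - x' \in ideal_gen.
  by rewrite Quotient.idealrBE /x' reprK.
have hy : y - y' \in ideal_gen.
  by rewrite Quotient.idealrBE /y' reprK.
have -> : x * y - x' * y' = y * (x - x') + x' * (y - y').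
  by rewrite !mulrBr addrA [y * x]mulrC [y * x']mulrC subrK.
by rewrite rpredD // ideal_genMl.
Qed.

Let rquot_ind (P : rquot -> Prop) : (forall p, P (\pi p)) -> forall x, P x.
Proof. by move=> h x; rewrite -[x]reprK. Qed.

Fact rquot_mulA : associative rquot_mul.
Proof.
by elim/rquot_ind=> x; elim/rquot_ind=> y; elim/rquot_ind=> z;
   rewrite -!pi_rquot_mul mulrA.
Qed.

Fact rquot_mulC : commutative rquot_mul.
Proof.
by elim/rquot_ind=> x; elim/rquot_ind=> y; rewrite -!pi_rquot_mul mulrC.
Qed.

Fact rquot_mul1 : left_id rquot_one rquot_mul.
Proof.
by elim/rquot_ind=> x; unlock rquot_one; rewrite -pi_rquot_mul mul1r.
Qed.

Fact rquot_mulDl : left_distributive rquot_mul +%R.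
Proof.
elim/rquot_ind=> x; elim/rquot_ind=> y; elim/rquot_ind=> z.
by rewrite -!pi_rquot_mul -!raddfD -!pi_rquot_mul mulrDl.
Qed.

HB.instance Definition _ := GRing.Zmodule_isComPzRing.Build rquot
  rquot_mulA rquot_mulC rquot_mul1 rquot_mulDl.

Fact pi_rquot_monoid_morphism : monoid_morphism (\pi_rquot : R -> rquot).
Proof.
by split=> [|x y]; [rewrite -[RHS]/rquot_one; unlock rquot_one | exact: pi_rquot_mul].
Qed.

Fact pi_rquot_eq0 p : (\pi_rquot p == 0 :> rquot) = (p \in ideal_gen).
Proof. by rewrite -[0](raddf0 \pi_rquot) -Quotient.idealrBE subr0. Qed.

End QuotientByGenerators.

Definition regular_sequence (R : comNzRingType) (s : seq R) : Prop :=
  (forall i, (i < size s)%N ->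
     GRing.lreg (\pi_(rquot (take i s)) s`_i : rquot (take i s))) /\
  (1 != 0 :> rquot s).

Section Graded.
Variables (K : fieldType) (n : nat).

Definition zariski_closed (Z : set ('I_n -> K)) : Prop :=
  exists S : set {mpoly K[n]}, Z = [set a | forall p, S p -> p.@[a] = 0].

Definition zariski_open (U : set ('I_n -> K)) : Prop := zariski_closed (~` U).

Definition linear_form (a : 'I_n -> K) : {mpoly K[n]} := \sum_i a i *: 'X_i.

Variable s : seq {mpoly K[n]}.

Definition graded_part (k : nat) : set (rquot s) :=
  [set \pi_(rquot s) p | p in [set p : {mpoly K[n]} | p \is k.-homog]].

Fact graded_partM k l (x y : rquot s) :
  graded_part k x -> graded_part l y -> graded_part (k + l) (x * y).
Proof.
move=> [p hp <-] [q hq <-]; exists (p * q); first exact: dhomogM.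
exact: pi_rquot_mul.
Qed.

(* The topology on the degree one part is the one of the affine space of
   coefficients; when [s] consists of forms of degree at least 2 the map sending
   [a] to the class of [linear_form a] is a linear isomorphism onto it. *)
Definition zariski_open1 (U : set (rquot s)) : Prop :=
  U `<=` graded_part 1 /\
  zariski_open [set a | U (\pi_(rquot s) (linear_form a))].

Definition for_general1 (P : rquot s -> Prop) : Prop :=
  exists U : set (rquot s),
    [/\ zariski_open1 U, U !=set0 & forall z, U z -> P z].

End Graded.

Arguments graded_part {K n} s k.

(* Main.v *)
Require Import Defs.
From HB Require Import structures.
From mathcomp Require Import all_boot all_order all_algebra.
From mathcomp Require Import boolp classical_sets functions reals.
From mathcomp Require Import complex mpoly.
From mathcomp Require Import fraction ring.

(** Let [n = m + 1] and let [f_j] be the [n] given forms.  Write [L_a] for the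
    linear form with coefficients [a]; it vanishes at [x] exactly when [a] and
    [x] are orthogonal, and such pairs [(a, x)] are called incident.

    The ideal is generated in degree [d], so multiplication by [L_a] is
    injective in degree [d - 1] when [L_a * P = \sum_j t_j f_j], with constants
    [t_j], forces [P = 0] ([ideal_gen_dhomog]).  Injectivity for one [a]
    propagates to a Zariski open set by linear algebra over the polynomial ring
    in the coordinates of [a].  The system [L_a * P + \sum_j c_j f_j = 0] is
    linear, with entries polynomial in [a].  Over the fraction field it either
    has a nonzero solution or its matrix has a right inverse; clearing
    denominators ([left_kernel_or_right_inverse_fun]), the second case gives a
    nonzero polynomial [delta] such that the system at [a] has only the zero
    solution as soon as [delta(a)] is nonzero.  The first case must be excluded:
    it provides a solution [(P, c)] depending polynomially on [a].  Its
    component [c] satisfies [\sum_j c_j(a) f_j(x) = 0] for all incident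
    [(a, x)], and the heart of the proof is that then [c = 0]
    ([incidence_relation_trivial]).

    Take such a [c], and suppose that every relation of smaller degree is
    trivial.  If all the partial derivatives of [c] also satisfy the relation,
    then they vanish and [c] is constant; since the [f_j] are linearly
    independent ([regular_sequence_free]), [c = 0].  Otherwise put
    [g_k(x) = \sum_j (d_k c_j)(a) f_j(x)] for a general [a].  Differentiating
    the relation in [a], along directions orthogonal to [x], shows that the
    vectors [(g_k(x))_k] and [x] are proportional for all [x] orthogonal to [a]
    ([incidence_derivative]): on that hyperplane [g_k] is [x_k] times a form
    [Q] of degree [d - 1 >= 1].  As the hyperplane has dimension at least [2],
    [Q] has a nontrivial zero [x1] there ([common_zero_on_hyperplane]); this is
    where [m >= 2] and [d >= 2] are essential.  The vector [(f_j(x1))_j] is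
    nonzero, because an artinian quotient leaves no common zero to the [f_j]
    ([artinian_no_common_zero]), and it is orthogonal to [c(a)] and to all the
    [(d_k c)(a)].  On the other hand the [x_k Q] span a space of dimension
    [n - 1] on the hyperplane, and [c(a)] is a further relation, so these
    vectors cannot all lie in one hyperplane unless [c(a) = 0]
    ([incidence_relation_at]).  This contradicts the generality of [a]. *)

Set Implicit Arguments.
Unset Strict Implicit.
Unset Printing Implicit Defensive.
Import Order.TTheory GRing.Theory Num.Theory.
Local Open Scope ring_scope.
Local Open Scope quotient_scope.

(** * Polynomials as functions *)

Lemma poly_vanish_punctured (K : numFieldType) (P : {poly K}) :
  (forall t, t != 0 -> P.[t] = 0) -> P = 0.
Proof.
move=> vanP; apply/eqP; apply: contraT => nzP.
pose s := [seq i.+1%:R : K | i <- iota 0 (size P)].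
have := @max_poly_roots _ P s nzP.
rewrite size_map size_iota ltnn; apply.
  apply/allP=> _ /mapP[i _ ->]; apply/rootP/vanP.
  by rewrite pnatr_eq0.
rewrite map_inj_uniq ?iota_uniq // => i j /eqP.
by rewrite eqr_nat eqSS => /eqP.
Qed.

Lemma exists_nonroot_punctured (K : numFieldType) (P : {poly K}) :
  P != 0 -> exists2 t, t != 0 & P.[t] != 0.
Proof.
move=> /eqP nzP; apply: contrapT => van; apply: nzP.
apply: poly_vanish_punctured => t nzt.
by apply/eqP; apply: contra_notT van => Pt; exists t.
Qed.

Lemma horner_neq0 (R : nzRingType) (P : {poly R}) t : P.[t] != 0 -> P != 0.
Proof. by apply: contraNneq => ->; rewrite horner0. Qed.

Section Line.
Variables (K : comNzRingType) (n : nat).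
Implicit Types (a v x : 'I_n -> K) (p q : {mpoly K[n]}).

(** The restriction of a polynomial to the parametrised line [a + t v]. *)
Definition line a v : {mpoly K[n]} -> {poly K} :=
  mmap polyC (fun i => (a i)%:P + v i *: 'X).

HB.instance Definition _ a v := GRing.RMorphism.on (line a v).

Lemma horner_line a v p t : (line a v p).[t] = p.@[fun i => a i + t * v i].
Proof.
rewrite /line /meval /mmap horner_sum; apply: eq_bigr => m _.
rewrite !hornerE horner_prod; congr (_ * _); apply: eq_bigr => i _.
by rewrite !hornerE [v i * t]mulrC.
Qed.

Lemma horner_line0 a v p : (line a v p).[0] = p.@[a].
Proof. by rewrite horner_line; apply: meval_eq => i; rewrite mul0r addr0. Qed.

(** Chain rule along a line: both sides are derivations in [p] relative to the
    morphism [line a v], so it is enough to compare them on constants and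
    variables. *)
Lemma deriv_line a v p : (line a v p)^`() = \sum_i v i *: line a v p^`M(i).
Proof.
pose chain q := (line a v q)^`() = \sum_i v i *: line a v q^`M(i).
have chainM q r : chain q -> chain r -> chain (q * r).
  rewrite /chain => hq hr; rewrite rmorphM derivM hq hr mulr_suml mulr_sumr.
  rewrite -big_split; apply: eq_bigr => i _ /=.
  by rewrite mderivM rmorphD !rmorphM scalerDr scalerAl scalerAr.
have chainC c : chain c%:MP.
  rewrite /chain {1}/line mmapC derivC big1 // => i _.
  by rewrite mderivC rmorph0 scaler0.
have chainX i : chain 'X_i.
  rewrite /chain {1}/line mmapX mmap1U !derivE add0r.
  have derX k : ('X_i : {mpoly K[n]})^`M(k) = (i == k)%:R.
    rewrite mderivX mnm1E; case: eqP => [->|_]; last by rewrite scale0r.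
    have -> : (U_(k) - U_(k))%MM = 0%MM.
      by apply/mnmP => j; rewrite mnmBE subnn mnm0E.
    by rewrite mpolyX0 scale1r.
  rewrite (bigD1 i) //= derX eqxx rmorph1 big1.
    by rewrite addr0.
  by move=> j ji; rewrite derX eq_sym (negPf ji) rmorph0 scaler0.
have chain1 : chain 1 by rewrite -mpolyC1.
elim/mpolyind: p => [|c m p _ _ IHp].
  by rewrite -(mpolyC0 _ K); apply: chainC.
have chainm : chain (c *: 'X_[m]).
  rewrite -mul_mpolyC mpolyXE_id; apply: (chainM) => //.
  apply: (big_ind chain); [exact: chain1|exact: chainM|move=> i _].
  elim: (m i) => [|k IHk]; first by rewrite expr0.
  by rewrite exprS; apply: (chainM).
rewrite rmorphD derivD chainm IHp -big_split; apply: eq_bigr => i _ /=.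
by rewrite mderivD rmorphD scalerDr.
Qed.

End Line.

Section CharZero.
Variables (K : numFieldType) (n : nat).
Implicit Types (a v x : 'I_n -> K) (p q : {mpoly K[n]}).

Lemma msize_leP p N :
  reflect (forall m, p@_m != 0 -> (mdeg m < N)%N) (msize p <= N)%N.
Proof.
rewrite msizeE; apply: (iffP (bigmax_leqP_seq _ _ _ _)) => h m.
  by rewrite -mcoeff_msupp => /h; apply.
by rewrite mcoeff_msupp => /h.
Qed.

Lemma msize_mderiv_le p N i : (msize p <= N.+1)%N -> (msize p^`M(i) <= N)%N.
Proof.
move=> /msize_leP sz_p; apply/msize_leP => m.
rewrite mcoeff_deriv -mulr_natr mulf_eq0 negb_or => /andP[/sz_p + _].
by rewrite mdegD mdeg1 addn1 ltnS.
Qed.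

Lemma mderiv_eq0_const p : (forall i, p^`M(i) = 0) -> p = (p@_0)%:MP.
Proof.
move=> dp0; apply/mpolyP => m; rewrite mcoeffC.
have [->|nz_m] := eqVneq m 0%MM; first by rewrite mulr1.
rewrite mulr0; have /existsP[i nz_mi] : [exists i, m i != 0%N].
  apply: contraNT nz_m => /existsPn m0; apply/eqP/mnmP => i.
  by rewrite mnm0E; apply/eqP; move: (m0 i); rewrite negbK.
have Ui_le : (U_(i) <= m)%MM.
  by apply/mnm_lepP => j; rewrite mnm1E; case: eqP => // <-; rewrite lt0n.
apply/eqP; move: (mcoeff_deriv i (m - U_(i))%MM p).
rewrite dp0 mcoeff0 submK //.
by move/esym/eqP; rewrite -mulr_natr mulf_eq0 pnatr_eq0 orbF.
Qed.

(** The partial derivatives of a function vanishing everywhere vanish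
    everywhere; by induction on the degree they are zero polynomials, and in
    characteristic zero only constants have zero derivatives. *)
Lemma mpoly_vanish p : (forall a, p.@[a] = 0) -> p = 0.
Proof.
elim: {p}(msize p) {-2}p (leqnn (msize p)) => [|N IHN] p sz_p van_p.
  by move: sz_p; rewrite leqn0 msize_poly_eq0 => /eqP.
have dp0 i : p^`M(i) = 0.
  apply: IHN => [|a]; first exact: msize_mderiv_le.
  pose v j : K := (j == i)%:R.
  have line0 : line a v p = 0.
    by apply: poly_vanish_punctured => t _; rewrite horner_line van_p.
  have := deriv_line a v p.
  rewrite line0 deriv0 => /(congr1 (fun P : {poly K} => P.[0])).
  rewrite horner0 horner_sum (bigD1 i) //= big1 => [|j ji]; last first.
    by rewrite /v (negPf ji) scale0r horner0.
  by rewrite /v eqxx scale1r addr0 horner_line0.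
have pE := mderiv_eq0_const dp0.
by move: (van_p (fun=> 0)); rewrite pE mevalC => ->.
Qed.

Lemma exists_nonroot p : p != 0 -> exists a, p.@[a] != 0.
Proof.
move=> /eqP nzp; apply: contrapT => van; apply: nzp.
apply: mpoly_vanish => a.
by apply/eqP; apply: contra_notT van => pa; exists a.
Qed.

End CharZero.

Lemma dhomog_meval (K : comNzRingType) n d (p : {mpoly K[n]}) (t : K) x :
  p \is d.-homog -> p.@[fun i => t * x i] = t ^+ d * p.@[x].
Proof.
move=> /dhomogP hp; rewrite !mevalE mulr_sumr big_seq [RHS]big_seq.
apply: eq_bigr => m /hp /= md; rewrite mulrCA; congr (_ * _).
under eq_bigr do rewrite exprMn.
by rewrite big_split /= -expr_sum -mdegE md.
Qed.

(** * Hyperplanes *)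

Definition dot (K : comNzRingType) n (a x : 'I_n -> K) : K := \sum_i a i * x i.

Section Dot.
Variables (K : comNzRingType) (n : nat).
Implicit Types (a b x y : 'I_n -> K).

Lemma dotC a x : dot a x = dot x a.
Proof. by apply: eq_bigr => i _; rewrite mulrC. Qed.

Lemma dotZr b x t : dot b (fun i => t * x i) = t * dot b x.
Proof. by rewrite /dot mulr_sumr; apply: eq_bigr => i _; rewrite mulrCA. Qed.

Lemma dotDr b x y t : dot b (fun i => x i + t * y i) = dot b x + t * dot b y.
Proof.
by rewrite -dotZr /dot -big_split; apply: eq_bigr => i _; rewrite mulrDr.
Qed.

Lemma dot_delta b k : dot b (fun i => (i == k)%:R) = b k.
Proof.
rewrite /dot (bigD1 k) //= eqxx mulr1 big1 ?addr0 // => i /negPf ->.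
by rewrite mulr0.
Qed.

Lemma dot0l x : dot (fun=> 0) x = 0.
Proof. by rewrite /dot big1 // => i _; rewrite mul0r. Qed.

Lemma meval_linear_form (F : fieldType) (b x : 'I_n -> F) :
  (linear_form b).@[x] = dot b x.
Proof.
rewrite /linear_form /dot raddf_sum /=.
by under eq_bigr do rewrite mevalZ mevalXU.
Qed.

End Dot.

Lemma linear_form_neq0 (K : fieldType) n (a : 'I_n -> K) i :
  a i != 0 -> linear_form a != 0.
Proof.
apply: contraNneq => a0.
have := meval_linear_form a (fun j => (j == i)%:R).
by rewrite a0 meval0 dot_delta => <-.
Qed.

Section Hyperplane.
Variables (K : fieldType) (n : nat) (a : 'I_n -> K) (i0 : 'I_n).
Hypothesis ai0 : a i0 != 0.

(** For [k] distinct from [i0] these vectors form the basis of the hyperplane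
    orthogonal to [a] whose coordinates other than the one at [i0] are those of
    the standard basis. *)
Definition hyp_vec (k j : 'I_n) : K :=
  (j == k)%:R + - (a k / a i0) * (j == i0)%:R.

Lemma dot_hyp_vec (b : 'I_n -> K) k :
  dot b (hyp_vec k) = b k - a k / a i0 * b i0.
Proof. by rewrite dotDr !dot_delta mulNr. Qed.

Lemma hyp_vec_orth k : dot a (hyp_vec k) = 0.
Proof. by rewrite dot_hyp_vec divfK ?subrr. Qed.

Lemma orth_hyperplane (b : 'I_n -> K) :
  (forall y, dot a y = 0 -> dot b y = 0) -> forall k, b k = b i0 / a i0 * a k.
Proof.
move=> orth k; move/eqP: (orth _ (hyp_vec_orth k)).
by rewrite dot_hyp_vec subr_eq0 => /eqP ->; field.
Qed.

End Hyperplane.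

Lemma exists_orth (K : fieldType) n (x : 'I_n -> K) :
  (1 < n)%N -> exists b i, b i != 0 /\ dot b x = 0.
Proof.
case: n x => [|[|n]] // x _.
have [x0|nzx0] := eqVneq (x ord0) 0; last first.
  exists (hyp_vec x ord0 ord_max), ord_max; rewrite dotC hyp_vec_orth //.
  by rewrite /hyp_vec eqxx mulr0 addr0 oner_neq0.
exists (fun i => (i == ord0)%:R), ord0; rewrite eqxx oner_neq0; split=> //.
by rewrite dotC dot_delta.
Qed.

(** * Relations on incident pairs *)

Section Bieval.
Variables (K : comNzRingType) (n p : nat).
Implicit Types (c f : 'I_p -> {mpoly K[n]}) (a x : 'I_n -> K).

Definition bieval c f a x : K := \sum_j (c j).@[a] * (f j).@[x].

Definition bieval_line c f a v x y : {poly K} :=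
  \sum_j line a v (c j) * line x y (f j).

Lemma horner_bieval_line c f a v x y t : (bieval_line c f a v x y).[t] =
  bieval c f (fun i => a i + t * v i) (fun i => x i + t * y i).
Proof.
rewrite horner_sum; apply: eq_bigr => j _.
by rewrite hornerM !horner_line.
Qed.

Lemma horner_bieval_line0 c f a v x y :
  (bieval_line c f a v x y).[0] = bieval c f a x.
Proof.
by rewrite horner_sum; apply: eq_bigr => j _; rewrite hornerM !horner_line0.
Qed.

Lemma meval_suml c (t : 'I_p -> K) a :
  (\sum_j t j *: c j).@[a] = \sum_j t j * (c j).@[a].
Proof. by rewrite raddf_sum /=; under eq_bigr do rewrite mevalZ. Qed.

End Bieval.

Section GenericPair.
Variables (K : numFieldType) (n k : nat).
Hypothesis n_gt1 : (1 < n)%N.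
Variables c f : 'I_k -> {mpoly K[n]}.

Lemma incident_pair_neq0 a x : dot a x = 0 -> bieval c f a x != 0 ->
  exists b i, [/\ b i != 0, dot b x = 0 & bieval c f b x != 0].
Proof.
move=> ax nz_ax.
have [[i ai]|a0] := pselect (exists i, a i != 0); first by exists a, i.
have {}a0 i : a i = 0 by apply/eqP; apply: contra_notT a0 => ai; exists i.
have [b [i [bi bx]]] := exists_orth x n_gt1.
pose P := bieval_line c f a b x (fun=> 0).
have /exists_nonroot_punctured[t nzt nzPt] : P != 0.
  by apply: (@horner_neq0 _ _ 0); rewrite horner_bieval_line0.
exists (fun i => a i + t * b i), i; rewrite a0 add0r mulf_neq0 //; split=> //.
  by rewrite dotC dotDr ![dot x _]dotC ax bx mulr0 addr0.
move: nzPt; rewrite horner_bieval_line /bieval.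
under eq_bigr => j _.
  rewrite [in X in _ * X](@meval_eq _ _ _ x) => [|h]; first over.
  by rewrite mulr0 addr0.
by [].
Qed.

(** The incidence variety is irreducible: a polynomial function which does not
    vanish identically on it is nonzero at some pair whose first component is
    nonzero and avoids a given hypersurface.  The pair is found on a curve
    through [(a, x)] whose first component runs along a line reaching outside
    the hypersurface. *)
Lemma generic_incident_pair (q : {mpoly K[n]}) a x :
  q != 0 -> dot a x = 0 -> bieval c f a x != 0 ->
  exists b y i, [/\ b i != 0, dot b y = 0, q.@[b] != 0 & bieval c f b y != 0].
Proof.
move=> /exists_nonroot[a1 qa1] ax nz_ax.
have {a ax nz_ax} [a [i0 [ai0 ax nz_ax]]] := incident_pair_neq0 ax nz_ax.
(* With [dot a w = 1], the vector [dot b w * x - dot b x * w] is orthogonal to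
   [b] for every [b], and equals [x] at [b = a]; it is affine in [t] along
   [b = a + t v]. *)
pose w (i : 'I_n) : K := (i == i0)%:R / a i0.
pose v i := a1 i - a i.
pose y i := dot v w * x i - dot v x * w i.
pose Q := bieval_line c f a v x y * line a v q * line a v 'X_i0.
have : Q != 0.
  rewrite !mulf_neq0 //.
  - by apply: (@horner_neq0 _ _ 0); rewrite horner_bieval_line0.
  - apply: (@horner_neq0 _ _ 1); rewrite horner_line.
    by rewrite (@meval_eq _ _ _ a1) // => h; rewrite mul1r addrC subrK.
  - by apply: (@horner_neq0 _ _ 0); rewrite horner_line0 mevalXU.
move=> /exists_nonroot_punctured[t _].
rewrite !hornerM !mulf_eq0 !negb_or horner_bieval_line !horner_line mevalXU.
set b := (fun i => a i + _); set z := (fun i => x i + _).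
move=> /andP[/andP[nz_bz qb] bi0]; exists b, z, i0; split=> //.
have dot_y h : dot h y = dot v w * dot h x - dot v x * dot h w.
  rewrite -!dotZr -sumrB; apply: eq_bigr => i _.
  by rewrite /y mulrBr.
have aw : dot a w = 1.
  rewrite (_ : dot a w = dot a (fun i => (a i0)^-1 * (i == i0)%:R)).
    by rewrite dotZr dot_delta mulVf.
  by apply: eq_bigr => i _; rewrite [(a i0)^-1 * _]mulrC.
rewrite dotDr dot_y ![dot b _]dotC !dotDr ![dot _ a]dotC ![dot _ v]dotC ax aw.
ring.
Qed.

(** Differentiating the relation at [a] in the direction [z_l e_k - z_k e_l],
    which is orthogonal to [z], keeps the pair incident. *)
Lemma incidence_derivative :
  (forall a x, dot a x = 0 -> bieval c f a x = 0) ->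
  let g a h := \sum_j (c j)^`M(h).@[a] *: f j in
  forall a z, dot a z = 0 ->
    forall h l, z l * (g a h).@[z] = z h * (g a l).@[z].
Proof.
move=> relc g a z az h l.
have gE i : (g a i).@[z] = (\sum_j (f j).@[z] *: c j)^`M(i).@[a].
  rewrite raddf_sum (raddf_sum (mderiv i)) [in RHS]raddf_sum.
  by apply: eq_bigr => j _ /=; rewrite mderivZ !mevalZ mulrC.
pose u i := z l * (i == h)%:R + - z h * (i == l)%:R.
have dot_u b : dot b u = z l * b h - z h * b l.
  by rewrite dotDr dotZr !dot_delta mulNr.
have line0 : line a u (\sum_j (f j).@[z] *: c j) = 0.
  apply: poly_vanish_punctured => s _; rewrite horner_line meval_suml.
  under eq_bigr do rewrite mulrC.
  by apply: relc; rewrite dotC dotDr dot_u dotC az; ring.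
have := deriv_line a u (\sum_j (f j).@[z] *: c j).
rewrite line0 deriv0 => /(congr1 (fun P : {poly K} => P.[0])).
rewrite horner0 horner_sum.
under eq_bigr do rewrite hornerZ horner_line0 mulrC.
move/esym/eqP; rewrite -[X in X == 0]/(dot _ u) dot_u subr_eq0 -!gE.
by move/eqP.
Qed.

End GenericPair.

Section IncidenceRelations.
Variables (K : numClosedFieldType) (n d : nat).
Hypotheses (n_gt2 : (2 < n)%N) (d_gt1 : (1 < d)%N).

(** On the hyperplane, proportionality means that [g_k = x_k * Q] for a form [Q]
    of degree [d - 1], of which a nontrivial zero is wanted.  On the affine line
    [q + s p] below, whose coordinate at [l] is [1], [Q] is the restriction [G]
    of [g_l].  If [G] has no root it is constant, and then [Q] vanishes at the
    point at infinity [p] of this line, because its degree is positive. *)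
Lemma common_zero_on_hyperplane (a : 'I_n -> K) i0 (g : 'I_n -> {mpoly K[n]}) :
  a i0 != 0 -> (forall k, g k \is d.-homog) ->
  (forall x, dot a x = 0 -> forall k l, x l * (g k).@[x] = x k * (g l).@[x]) ->
  exists x, [/\ exists i, x i != 0, dot a x = 0 & forall k, (g k).@[x] = 0].
Proof.
move=> ai0 homg propg.
have /card_gt1P[k [l []]] : (1 < #|[set~ i0]|)%N.
  by rewrite cardsC1 card_ord; case: n n_gt2 => [|[|[]]].
rewrite !inE => ki0 li0 kl.
pose p := hyp_vec a i0 k; pose q := hyp_vec a i0 l.
have [pk pl] : p k = 1 /\ p l = 0.
  rewrite /p /hyp_vec (negPf ki0) (negPf li0) eqxx eq_sym (negPf kl).
  by rewrite !mulr0 !addr0.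
have [ql qk] : q l = 1 /\ q k = 0.
  rewrite /q /hyp_vec (negPf ki0) (negPf li0) eqxx (negPf kl).
  by rewrite !mulr0 !addr0.
have zero_at x j : dot a x = 0 -> x j = 1 -> (g j).@[x] = 0 ->
    exists x, [/\ exists i, x i != 0, dot a x = 0 & forall k, (g k).@[x] = 0].
  move=> ax xj gj; exists x; split=> // [|h].
    by exists j; rewrite xj oner_eq0.
  by rewrite -[LHS]mul1r -xj propg // gj mulr0.
pose G := line q p (g l).
have orth t : dot a (fun i => q i + t * p i) = 0.
  by rewrite dotDr !hyp_vec_orth // mulr0 addr0.
have [szG|] := boolP (size G == 1); last first.
  move=> /closed_rootP[s /rootP]; rewrite horner_line => Gs.
  by apply: (zero_at _ l _ _ Gs); rewrite ?orth // ql pl mulr0 addr0.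
have {szG} GE : G = (G`_0)%:P by apply: size1_polyC; rewrite (eqP szG).
apply: (zero_at p k) => //; first exact: hyp_vec_orth.
have : line p q (g k) - G`_0 *: 'X^(d.-1) = 0.
  apply: poly_vanish_punctured => t nzt; rewrite !hornerE horner_line.
  have -> : (g k).@[fun i => p i + t * q i] =
            (g k).@[fun i => t * (q i + t^-1 * p i)].
    apply: meval_eq => i /=.
    by rewrite [RHS]mulrDr mulrA divff // mul1r addrC.
  rewrite (dhomog_meval _ _ (homg k)).
  have := propg _ (orth t^-1) k l.
  rewrite ql pl qk pk mulr0 addr0 add0r mul1r mulr1 => ->.
  rewrite -(horner_line q p) -/G GE hornerC coefC eqxx.
  by rewrite -[in t ^+ d](ltn_predK d_gt1) exprS; field.
move=> /(congr1 (fun P : {poly K} => P.[0])).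
rewrite !hornerE horner_line0 expr0n; case: d d_gt1 => [|[|e]] //= _.
by rewrite mulr0 subr0.
Qed.

Variable f : 'I_n -> {mpoly K[n]}.
Hypothesis f_homog : forall j, f j \is d.-homog.
Hypothesis f_nozero : forall x : 'I_n -> K,
  (exists i, x i != 0) -> exists j, (f j).@[x] != 0.

(** At a common zero [x1] of the [g_k] the vector [(f_j(x1))_j] is nonzero and
    killed by the matrix [D] as well as by [c], hence by every matrix
    [D + u c], where [u] is a column and [c] a row.  So this matrix has a
    nonzero left kernel vector [r], and [\sum_k r_k g_k = 0] on the hyperplane.
    By proportionality the linear form of [r] vanishes there, so [r] is a
    multiple of [a]: thus [a D + dot a u * c = 0] for every [u], which is only
    possible for [c = 0]. *)
Lemma incidence_relation_at (a : 'I_n -> K) i0 (c : 'I_n -> K)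
    (D : 'I_n -> 'I_n -> K) :
  let g k := \sum_j D k j *: f j in
  a i0 != 0 ->
  (forall x, dot a x = 0 -> \sum_j c j * (f j).@[x] = 0) ->
  (forall x, dot a x = 0 -> forall k l, x l * (g k).@[x] = x k * (g l).@[x]) ->
  (exists x l, dot a x = 0 /\ (g l).@[x] != 0) ->
  forall j, c j = 0.
Proof.
move=> g ai0 relc propg [x0 [l [ax0 gl0]]].
have gE k x : (g k).@[x] = \sum_j D k j * (f j).@[x] by apply: meval_suml.
have homg k : g k \is d.-homog by apply: rpred_sum => j _; apply: rpredZ.
have [x1 [nzx1 ax1 gx1]] := common_zero_on_hyperplane ai0 homg propg.
have aD u j : \sum_k a k * D k j + dot a u * c j = 0.
  pose M := \matrix_(k, j) (D k j + u k * c j).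
  have /det0P[r nzr rM] : \det M == 0.
    rewrite -det_tr; apply/det0P; exists (\row_j (f j).@[x1]).
      have [h fh] := f_nozero nzx1; apply: contraNneq fh => /rowP/(_ h).
      by rewrite !mxE => ->.
    apply/rowP=> k; rewrite !mxE; under eq_bigr do rewrite !mxE mulrDr.
    rewrite big_split /=; under eq_bigr do rewrite mulrC.
    rewrite -gE gx1 add0r; under eq_bigr do rewrite mulrCA [_ * c _]mulrC.
    by rewrite -mulr_sumr relc // mulr0.
  have rME h : \sum_k r 0 k * D k h = - (dot (r 0) u * c h).
    apply/eqP; rewrite -addr_eq0; apply/eqP.
    have := congr1 (fun w : 'rV[K]_n => w 0 h) rM; rewrite !mxE => rMh.
    apply: etrans rMh; rewrite /dot mulr_suml -big_split.
    apply: eq_bigr => k _ /=.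
    by rewrite !mxE mulrDr mulrA.
  have rg x : dot a x = 0 -> \sum_k r 0 k * (g k).@[x] = 0.
    move=> ax; under eq_bigr do rewrite gE mulr_sumr.
    rewrite exchange_big /=; under eq_bigr => h _.
      under eq_bigr do rewrite mulrA.
      rewrite -mulr_suml rME mulNr -mulrA; over.
    by rewrite sumrN -mulr_sumr relc // mulr0 oppr0.
  have orth_r y : dot a y = 0 -> dot (r 0) y = 0.
    move=> ay; have /eqP : line x0 y (linear_form (r 0)) * line x0 y (g l) = 0.
      apply: poly_vanish_punctured => t _.
      rewrite hornerM !horner_line meval_linear_form.
      set x := (fun i => _).
      have ax : dot a x = 0 by rewrite dotDr ax0 ay mulr0 addr0.
      rewrite /dot mulr_suml.
      under eq_bigr do rewrite -mulrA -propg // mulrCA.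
      by rewrite -mulr_sumr rg // mulr0.
    rewrite mulf_eq0 => /orP[] /eqP line0.
      have lin t : dot (r 0) x0 + t * dot (r 0) y = 0.
        by rewrite -dotDr -meval_linear_form -horner_line line0 horner0.
      by move: (lin 0) (lin 1); rewrite mul0r mul1r addr0 => ->; rewrite add0r.
    by move: gl0; rewrite -(horner_line0 _ y) line0 horner0 eqxx.
  have rE := orth_hyperplane ai0 orth_r.
  have nzt : r 0 i0 / a i0 != 0.
    apply: contraNneq nzr => t0; apply/eqP/rowP => k.
    by rewrite rE t0 mul0r mxE.
  apply: (mulfI nzt); rewrite mulr0 mulrDr mulr_sumr.
  under eq_bigr do rewrite mulrA -rE.
  have -> : \sum_k r 0 k * D k j = - (r 0 i0 / a i0 * dot a u * c j).
    rewrite rME /dot mulr_sumr; congr (- (_ * _)).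
    by apply: eq_bigr => k _; rewrite [in LHS]rE mulrA.
  by rewrite mulrA addNr.
(* Compare [u = 0] with a [u] for which [dot a u = a i0] is nonzero. *)
move=> j; have := aD (fun i => (i == i0)%:R) j; have := aD (fun=> 0) j.
rewrite dotC dot0l mul0r addr0 => ->; rewrite add0r dot_delta.
by move/eqP; rewrite mulf_eq0 (negPf ai0) => /eqP.
Qed.

Hypothesis f_free : forall t : 'I_n -> K,
  \sum_j t j *: f j = 0 -> forall j, t j = 0.

(** Induction on a bound for the degrees of the [c_j], which partial
    differentiation decreases. *)
Lemma incidence_relation_trivial (c : 'I_n -> {mpoly K[n]}) :
  (forall a x, dot a x = 0 -> bieval c f a x = 0) -> forall j, c j = 0.
Proof.
have [N] : exists N, forall j, (msize (c j) <= N)%N.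
  by exists (\max_j msize (c j))%N => j; apply: leq_bigmax.
elim: N c => [|N IHN] c sz_c relc j.
  by apply/eqP; rewrite -msize_poly_eq0 -leqn0.
have [reldc|] := pselect (forall k a x, dot a x = 0 ->
    bieval (fun i => (c i)^`M(k)) f a x = 0).
  have dc0 k i : (c i)^`M(k) = 0.
    apply: (IHN (fun i => (c i)^`M(k))) => [h|]; last exact: reldc.
    exact: msize_mderiv_le.
  have cE i := mderiv_eq0_const (dc0^~ i).
  rewrite cE; apply/eqP; rewrite mpolyC_eq0; apply/eqP.
  apply: (f_free (t := fun j => (c j)@_0)); apply: mpoly_vanish => x.
  (* The zero vector is incident to every [x]. *)
  rewrite meval_suml -[RHS](relc (fun=> 0) x (dot0l x)).
  by apply: eq_bigr => i _; rewrite [in RHS]cE mevalC.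
move=> /existsNP[k /existsNP[a0 /existsNP[x0 /not_implyP[ax0 /eqP nz0]]]].
apply/eqP; apply: contraT => nzcj.
have [a [x [i [ai ax ca nz_ax]]]] :=
  generic_incident_pair (ltnW n_gt2) nzcj ax0 nz0.
have ca0 :=
  incidence_relation_at ai (relc a) (incidence_derivative relc (a := a)).
rewrite ca0 ?eqxx // in ca.
by exists x, k; split=> //; rewrite meval_suml.
Qed.

End IncidenceRelations.

(** * Linear systems over an integral domain *)

Section KernelOrInverse.
Variable D : idomainType.
Local Notation F := {fraction D}.
Local Notation frac := (@FracField.tofrac D).

Lemma fraction_denominator (x : F) : exists d e, d != 0 /\ frac d * x = frac e.
Proof.
elim/quotW: x => x; exists \d_x, \n_x; split; first exact: denom_ratioP.
unlock FracField.tofrac; rewrite -[LHS]FracField.pi_mul.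
apply/eqmodP; rewrite /= FracField.equivfE /FracField.mulf.
by rewrite !numden_Ratio ?(oner_eq0, mul1r, denom_ratioP) // mulr1.
Qed.

Lemma common_denominator p q (X : 'M[F]_(p, q)) :
  exists d (Y : 'M[D]_(p, q)), d != 0 /\ frac d *: X = map_mx frac Y.
Proof.
pose denom (k : 'I_p * 'I_q) (de : D * D) :=
  de.1 != 0 /\ frac de.1 * X k.1 k.2 = frac de.2.
have [de dE] : exists de : 'I_p * 'I_q -> D * D, forall k, denom k (de k).
  apply: (@fin_all_exists _ _ denom) => k.
  by have [d [e ?]] := fraction_denominator (X k.1 k.2); exists (d, e).
exists (\prod_k (de k).1).
exists (\matrix_(i, j) (\prod_(k | k != (i, j)) (de k).1 * (de (i, j)).2)).
split; first by apply/prodf_neq0 => k _; case: (dE k).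
apply/matrixP => i j; rewrite !mxE (bigD1 (i, j)) //= mulrC !rmorphM /=.
by rewrite -(dE (i, j)).2 mulrA mulrC [frac (de _).1 * _]mulrC.
Qed.

Lemma map_frac_inj p q : injective (map_mx frac : 'M_(p, q) -> 'M_(p, q)).
Proof.
move=> X Y /matrixP XY; apply/matrixP => i j.
by apply/eqP; rewrite -tofrac_eq; move: (XY i j); rewrite !mxE => ->.
Qed.

(** A matrix over the fraction field has a nonzero left kernel or a right
    inverse; clear the denominators of either. *)
Lemma left_kernel_or_right_inverse p q (M : 'M[D]_(p, q)) :
  (exists2 u : 'rV_p, u != 0 & u *m M = 0) \/
  (exists d (B : 'M_(q, p)), d != 0 /\ M *m B = d%:M).
Proof.
have [|] := boolP (row_free (map_mx frac M)).
  move=> /row_freeP[B MB]; right.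
  have [d [B' [nzd dB]]] := common_denominator B; exists d, B'; split=> //.
  apply: map_frac_inj.
  by rewrite map_mxM -dB -scalemxAr MB map_scalar_mx scalemx1.
rewrite -kermx_eq0 => /rowV0Pn[u /sub_kermxP uM nzu]; left.
have [d [u' [nzd du]]] := common_denominator u; exists u'.
  apply: contraNneq nzu => u'0; move: du; rewrite u'0 map_mx0 => /eqP.
  by rewrite scaler_eq0 tofrac_eq0 (negPf nzd).
by apply: map_frac_inj; rewrite map_mxM -du -scalemxAl uM scaler0 map_mx0.
Qed.

Lemma left_kernel_or_right_inverse_fun (I J : finType) (M : I -> J -> D) :
  (exists2 u : I -> D, exists i, u i != 0 & forall j, \sum_i u i * M i j = 0) \/
  (exists d (B : J -> I -> D), d != 0 /\
     forall i k, \sum_j M i j * B j k = d *+ (i == k)).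
Proof.
pose A := \matrix_(i < #|I|, j < #|J|) M (enum_val i) (enum_val j).
have [[u nzu uA]|[d [B [nzd AB]]]] := left_kernel_or_right_inverse A.
  left; exists (fun i => u 0 (enum_rank i)) => [|j].
    have /rV0Pn[i ui] := nzu; exists (enum_val i).
    by rewrite enum_valK.
  have := congr1 (fun w : 'rV_ _ => w 0 (enum_rank j)) uA; rewrite !mxE => uAj.
  apply: etrans uAj; rewrite (reindex _ (onW_bij _ (enum_val_bij I))) /=.
  by apply: eq_bigr => i _; rewrite !mxE !enum_valK enum_rankK.
right; exists d, (fun j i => B (enum_rank j) (enum_rank i)); split=> // i k.
have := congr1 (fun w : 'M_ _ => w (enum_rank i) (enum_rank k)) AB.
rewrite !mxE (inj_eq enum_rank_inj) => ABik; apply: etrans ABik.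
rewrite (reindex _ (onW_bij _ (enum_val_bij J))) /=.
by apply: eq_bigr => j _; rewrite !mxE !enum_valK enum_rankK.
Qed.

End KernelOrInverse.

(** * Ideals generated by forms *)

Lemma mem_ideal_gen (R : comNzRingType) (s : seq R) i :
  (i < size s)%N -> s`_i \in ideal_gen s.
Proof.
move=> i_s; apply/asboolP; exists (fun j => (nat_of_ord j == i)%:R).
rewrite (bigD1 (Ordinal i_s)) //= eqxx mul1r big1 ?addr0 // => j.
by rewrite -val_eqE /= => /negPf ->; rewrite mul0r.
Qed.

Lemma ideal_gen_sub (R : comNzRingType) (s s' : seq R) p :
  (forall i, (i < size s)%N -> s`_i \in ideal_gen s') ->
  p \in ideal_gen s -> p \in ideal_gen s'.
Proof.
move=> ss' /asboolP[c ->]; apply: rpred_sum => i _.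
by apply: ideal_genMl; apply: ss'.
Qed.

Lemma pi_rquot_eq (R : comNzRingType) (s : seq R) p q :
  (\pi_(rquot s) p = \pi_(rquot s) q) <-> (p - q \in ideal_gen s).
Proof.
rewrite -pi_rquot_eq0 raddfB subr_eq0; split=> [pq|/eqP //].
exact/eqP.
Qed.

(** In a linear relation between the terms of a regular sequence, the last one
    with a nonzero coefficient lies in the ideal of the previous ones, so it
    acts as zero on the quotient; it is regular there only if that quotient is
    trivial. *)
Lemma regular_sequence_free (K : fieldType) n (k : nat)
    (f : k.-tuple {mpoly K[n]}) (t : 'I_k -> K) :
  regular_sequence f -> \sum_j t j *: tnth f j = 0 -> forall j, t j = 0.
Proof.
move=> [reg nz1] rel j0; apply/eqP; apply: contraT => tj0; exfalso.
have [j tj maxj] :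
    exists2 j : 'I_k, t j != 0 & forall i, t i != 0 -> (i <= j)%N.
  by case: (@arg_maxnP _ j0 (fun j => t j != 0) val tj0) => j; exists j.
have sz_take : size (take j f) = j by rewrite size_takel // size_tuple ltnW.
have fj : f`_j \in ideal_gen (take j f).
  have -> : f`_j = (t j)^-1%:MP * - \sum_(i | i != j) t i *: tnth f i.
    move/eqP: rel; rewrite (bigD1 j) //= addrC addr_eq0 => /eqP ->.
    by rewrite opprK mul_mpolyC scalerA mulVf // scale1r (tnth_nth 0).
  apply: ideal_genMl; rewrite rpredN; apply: rpred_sum => i ij.
  have [->|ti] := eqVneq (t i) 0; first by rewrite scale0r rpred0.
  have lt_ij : (i < j)%N by rewrite ltn_neqAle maxj // andbT.
  rewrite -mul_mpolyC (tnth_nth 0) -(nth_take _ lt_ij).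
  by apply: ideal_genMl; apply: mem_ideal_gen; rewrite sz_take.
have /reg : (j < size f)%N by rewrite size_tuple.
have /eqP -> : \pi_(rquot (take j f)) f`_j == 0 by rewrite pi_rquot_eq0.
move=> /(_ 1 0); rewrite !mul0r => /(_ erefl) /eqP.
rewrite -[1](pi_rquot_monoid_morphism _).1 pi_rquot_eq0 => one_in.
move/negP: nz1; apply; rewrite -(pi_rquot_monoid_morphism _).1 pi_rquot_eq0.
apply: ideal_gen_sub one_in => i; rewrite sz_take => ij.
by rewrite nth_take //; apply: mem_ideal_gen; rewrite size_tuple (ltn_trans ij).
Qed.

(** Restriction to the line spanned by a common zero maps the quotient onto a
    polynomial ring in one variable, where the ideals generated by the powers of
    the variable decrease strictly. *)
Lemma artinian_no_common_zero (K : numFieldType) n d (s : seq {mpoly K[n]}) :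
  (forall i, (i < size s)%N -> s`_i \is d.-homog) ->
  artinian (rquot s) ->
  forall x : 'I_n -> K, (exists i, x i != 0) ->
    exists2 j, (j < size s)%N & (s`_j).@[x] != 0.
Proof.
move=> homs art x [i nzxi]; apply: contrapT => nos.
have s0 j : (j < size s)%N -> (s`_j).@[x] = 0.
  by move=> js; apply/eqP; apply: contra_notT nos => sj; exists j.
pose ev := line (fun=> 0) x.
have ev0 p : p \in ideal_gen s -> ev p = 0.
  move=> /asboolP[c ->]; rewrite /ev rmorph_sum big1 // => j _.
  rewrite rmorphM /= [X in _ * X](_ : _ = 0) ?mulr0 //.
  apply: poly_vanish_punctured => t _; rewrite horner_line.
  under meval_eq do rewrite add0r.
  by rewrite (dhomog_meval _ _ (homs j (ltn_ord j))) s0 // mulr0.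
have evE p q : \pi_(rquot s) p = \pi_(rquot s) q -> ev p = ev q.
  move=> /pi_rquot_eq/ev0; rewrite /ev rmorphB => /eqP.
  by rewrite subr_eq0 => /eqP.
pose J k : set (rquot s) :=
  fun y => exists p r, \pi_(rquot s) p = y /\ ev p = r * 'X^k.
have [] := art J.
- move=> k; split.
  + by exists 0, 0; rewrite mul0r /ev rmorph0 raddf0.
  + move=> _ _ [p [r [<- pr]]] [q [r' [<- qr]]]; exists (p + q), (r + r').
    by rewrite raddfD /ev rmorphD /= -!/(ev _) pr qr mulrDl.
  + move=> y _ [q [r [<- qr]]]; exists (repr y * q), (ev (repr y) * r).
    by rewrite pi_rquot_mul reprK /ev rmorphM /= -!/(ev _) qr mulrA.
- move=> k y [p [r [<- pr]]]; exists p, (r * 'X).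
  by rewrite pr exprS mulrA.
move=> N /(_ N.+1 (leqnSn N)) JN.
have : J N (\pi_(rquot s) ('X_i ^+ N)).
  exists ('X_i ^+ N), (x i ^+ N)%:P; split=> //.
  rewrite /ev rmorphXn /= /line mmapX mmap1U add0r.
  by rewrite -mul_polyC exprMn rmorphXn.
rewrite -JN => -[p [r [/evE pE pr]]].
have := congr1 (fun P : {poly K} => P`_N) pr.
rewrite pE /ev rmorphXn /= /line mmapX mmap1U add0r.
rewrite exprZn coefZ coefXn eqxx mulr1.
by rewrite coefMXn ltnSn => /eqP; rewrite expf_eq0 (negPf nzxi) andbF.
Qed.

Lemma mcoeff_mul_dhomog (R : comNzRingType) n d (f c : {mpoly R[n]})
    (m : 'X_{1..n}) :
  f \is d.-homog -> (mdeg m <= d)%N -> (c * f)@_m = c@_0 * f@_m.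
Proof.
move=> homf le_md; elim/mpolyind: c => [|k m' p _ _ IHp].
  by rewrite mul0r !mcoeff0 mul0r.
rewrite mulrDl -scalerAl !mcoeffD !mcoeffZ IHp mulrDl mcoeffX; congr (_ + _).
have [->|nzm'] := eqVneq m' 0%MM; first by rewrite mpolyX0 mul1r mulr1.
have homX : 'X_[m'] * f \is (mdeg m' + d).-homog.
  by apply: dhomogM => //; rewrite dhomogX.
rewrite mulr0 mul0r (dhomog_nemf_coeff homX) ?mulr0 //.
rewrite neq_ltn (leq_ltn_trans le_md) // -{1}[d]add0n ltn_add2r lt0n mdeg_eq0.
by rewrite nzm'.
Qed.

Section IdealGenDegree.
Variables (K : fieldType) (n k d : nat) (f : k.-tuple {mpoly K[n]}).
Hypothesis f_homog : forall j, tnth f j \is d.-homog.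

(** In degrees at most [d] only the constant terms of the coefficients of a
    combination of the forms [f_j] matter. *)
Lemma ideal_gen_mcoeff p : p \in ideal_gen f -> exists t : 'I_k -> K,
  forall m, (mdeg m <= d)%N -> p@_m = (\sum_j t j *: tnth f j)@_m.
Proof.
move=> /asboolP[c ->].
exists (fun j => (c (cast_ord (esym (size_tuple f)) j))@_0) => m le_md.
rewrite !raddf_sum /= (reindex (cast_ord (esym (size_tuple f)))) /=; last first.
  by exists (cast_ord (size_tuple f)) => i _; rewrite (cast_ordK, cast_ordKV).
apply: eq_bigr => j _; rewrite mcoeffZ (tnth_nth 0).
by rewrite -(mcoeff_mul_dhomog _ _ le_md) // -tnth_nth.
Qed.

Lemma dhomog_span (t : 'I_k -> K) : \sum_j t j *: tnth f j \is d.-homog.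
Proof. by apply: rpred_sum => j _; apply: rpredZ; apply: f_homog. Qed.

Lemma ideal_gen_dhomog p : p \is d.-homog -> p \in ideal_gen f ->
  exists t : 'I_k -> K, p = \sum_j t j *: tnth f j.
Proof.
move=> homp /ideal_gen_mcoeff[t pE]; exists t; apply/mpolyP => m.
have [/pE //|gt_d] := leqP (mdeg m) d.
have ne_md : mdeg m != d by rewrite neq_ltn gt_d orbT.
by rewrite (dhomog_nemf_coeff homp) // (dhomog_nemf_coeff (dhomog_span t)).
Qed.

Lemma ideal_gen_low_degree e p :
  (e < d)%N -> p \is e.-homog -> p \in ideal_gen f -> p = 0.
Proof.
move=> lt_ed homp /ideal_gen_mcoeff[t pE]; apply/mpolyP => m; rewrite mcoeff0.
have [me|] := eqVneq (mdeg m) e; last exact: dhomog_nemf_coeff homp.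
rewrite pE ?me ?(ltnW lt_ed) // (dhomog_nemf_coeff (dhomog_span t)) //=.
by rewrite me ltn_eqF.
Qed.

End IdealGenDegree.

(** * Multiplication by a general linear form *)

Section Generic.
Variables (K : numClosedFieldType) (n d : nat).
Hypotheses (n_gt2 : (2 < n)%N) (d_gt1 : (1 < d)%N).
Variable f : 'I_n -> {mpoly K[n]}.
Hypothesis f_homog : forall j, f j \is d.-homog.
Hypothesis f_nozero : forall x : 'I_n -> K,
  (exists i, x i != 0) -> exists j, (f j).@[x] != 0.
Hypothesis f_free : forall t : 'I_n -> K,
  \sum_j t j *: f j = 0 -> forall j, t j = 0.

(** The unknowns of the linear system are the coefficients of [P], indexed by
    the monomials of degree less than [d], and the coefficients of the
    combination of the [f_j]; its equations are indexed by the monomials of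
    degree at most [d]. *)
Lemma generic_linear_form_injective :
  exists delta : {mpoly K[n]}, delta != 0 /\
    forall a, delta.@[a] != 0 -> forall (P : {mpoly K[n]}) (t : 'I_n -> K),
      (msize P <= d)%N -> linear_form a * P = \sum_j t j *: f j -> P = 0.
Proof.
pose row (a : 'I_n -> K) (s : 'X_{1..n < d} + 'I_n) : {mpoly K[n]} :=
  match s with inl m => linear_form a * 'X_[m] | inr j => f j end.
pose M (s : 'X_{1..n < d} + 'I_n) (v : 'X_{1..n < d.+1}) : {mpoly K[n]} :=
  match s with
  | inl m => \sum_i ('X_i * 'X_[bmnm m])@_v *: 'X_i
  | inr j => ((f j)@_v)%:MP
  end.
have ME a s v : (M s v).@[a] = (row a s)@_v.
  case: s => [m|j] /=; last by rewrite mevalC.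
  rewrite /linear_form mulr_suml !raddf_sum /=; apply: eq_bigr => i _.
  by rewrite mevalZ mevalXU -scalerAl mcoeffZ mulrC.
have rowE a (w : 'X_{1..n < d} + 'I_n -> K) : \sum_s w s *: row a s =
    linear_form a * (\sum_m w (inl m) *: 'X_[bmnm m]) + \sum_j w (inr j) *: f j.
  rewrite big_sumType /= mulr_sumr; congr (_ + _).
  by apply: eq_bigr => m _; rewrite scalerAr.
have sumX (w : 'X_{1..n < d} -> K) m :
    (\sum_m w m *: 'X_[bmnm m])@_(bmnm m) = w m.
  rewrite raddf_sum /= (bigD1 m) //= mcoeffZ mcoeffX eqxx mulr1.
  rewrite big1 ?addr0 // => m' m'm.
  by rewrite mcoeffZ mcoeffX [_ == bmnm m](negPf m'm) mulr0.
have [[u [s us] uM]|[delta [B [nz_delta MB]]]] :=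
  left_kernel_or_right_inverse_fun M.
  exfalso.
  have rel a : \sum_s (u s).@[a] *: row a s = 0.
    apply/mpolyP => v; rewrite mcoeff0 raddf_sum /=.
    have [lt_vd|ge_vd] := ltnP (mdeg v) d.+1.
      have := congr1 (meval a) (uM (BMultinom lt_vd)).
      rewrite raddf_sum meval0 => uMa; apply: etrans uMa.
      by apply: eq_bigr => s' _ /=; rewrite mcoeffZ mevalM ME.
    apply: big1 => s' _; rewrite mcoeffZ [X in _ * X](_ : _ = 0) ?mulr0 //.
    case: s' => [m|j] /=; last first.
      by apply: (dhomog_nemf_coeff (f_homog j)); rewrite neq_ltn ge_vd orbT.
    rewrite /linear_form mulr_suml raddf_sum big1 //= => i _.
    rewrite -scalerAl mcoeffZ -mpolyXD mcoeffX.
    case: eqP => [vE|]; last by rewrite mulr0.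
    by move: ge_vd; rewrite -vE mdegD mdeg1 add1n ltnS leqNgt bmdeg.
  have c0 : forall j, u (inr j) = 0.
    apply: (incidence_relation_trivial n_gt2 d_gt1 f_homog f_nozero f_free).
    move=> a x ax; have := congr1 (meval x) (rel a).
    rewrite rowE mevalD mevalM meval_linear_form ax.
    by rewrite mul0r add0r meval_suml meval0.
  case: s us => [m|j]; last by rewrite c0 eqxx.
  move/negP; apply; pose i0 : 'I_n := Ordinal (ltnW (ltnW n_gt2)).
  (* The factor 'X_i0 excludes the points where the linear form may vanish. *)
  have /eqP : u (inl m) * 'X_i0 = 0.
    apply: mpoly_vanish => a; rewrite mevalM mevalXU.
    have [->|ai0] := eqVneq (a i0) 0; first by rewrite mulr0.
    have /eqP := rel a; rewrite rowE [X in _ + X]big1 => [|j _]; last first.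
      by rewrite c0 meval0 scale0r.
    rewrite addr0 mulf_eq0 (negPf (linear_form_neq0 ai0)) => /eqP P0.
    by rewrite -(sumX (fun m => (u (inl m)).@[a])) P0 mcoeff0 mul0r.
  by rewrite mulf_eq0 => /orP[//|]; rewrite -msize_poly_eq0 msizeX.
exists delta; split=> // a nz_da P t szP LP.
pose w (s : 'X_{1..n < d} + 'I_n) : K :=
  match s with inl m => P@_(bmnm m) | inr j => - t j end.
have w0 s : w s = 0.
  have wrow : \sum_s w s *: row a s = 0.
    rewrite rowE /= -mpolywE // LP -big_split big1 //= => j _.
    by rewrite scaleNr subrr.
  have wM v : \sum_s' w s' * (M s' v).@[a] = 0.
    transitivity (\sum_s' w s' *: row a s')@_v; last by rewrite wrow mcoeff0.
    rewrite raddf_sum; apply: eq_bigr => s' _ /=.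
    by rewrite ME mcoeffZ.
  have /eqP : w s * delta.@[a] = 0.
    transitivity (\sum_v (\sum_s' w s' * (M s' v).@[a]) * (B v s).@[a]);
      last by apply: big1 => v _; rewrite wM mul0r.
    under eq_bigr do rewrite mulr_suml.
    rewrite exchange_big /= (bigD1 s) //= [X in _ + X]big1 => [|s' s's].
      under eq_bigr do rewrite -mulrA -mevalM.
      by rewrite -mulr_sumr -raddf_sum /= MB eqxx addr0.
    under eq_bigr do rewrite -mulrA -mevalM.
    by rewrite -mulr_sumr -raddf_sum /= MB (negPf s's) meval0 mulr0.
  by rewrite mulf_eq0 (negPf nz_da) orbF => /eqP.
rewrite (mpolywE szP) big1 // => m _.
by have /= -> := w0 (inl m); rewrite scale0r.
Qed.

End Generic.

Local Open Scope classical_set_scope.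

Theorem corollary4 (R : realType) (m d : nat) (hm : (2 <= m)%N) (hd : (2 <= d)%N)
  (f : (m.+1).-tuple {mpoly R[i][m.+1]})
  (f_homog : forall j : 'I_m.+1, tnth f j \is d.-homog)
  (f_regular : regular_sequence f)
  (A_artinian : artinian (rquot f)) :
  for_general1 (fun z : rquot f =>
    set_inj (graded_part f d.-1) (fun P : rquot f => z * P)).
Proof.
have f_nozero (x : 'I_m.+1 -> R[i]) :
    (exists i, x i != 0) -> exists j, (tnth f j).@[x] != 0.
  move=> nzx; have homf i : (i < size f)%N -> f`_i \is d.-homog.
    rewrite size_tuple => lt_im; have := f_homog (Ordinal lt_im).
    by rewrite (tnth_nth 0).
  have [j jf fj] := artinian_no_common_zero homf A_artinian nzx.
  have lt_jm : (j < m.+1)%N by rewrite -(size_tuple f).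
  by exists (Ordinal lt_jm); rewrite (tnth_nth 0).
have [delta [nz_delta inj_delta]] :=
  generic_linear_form_injective (n := m.+1) hm hd f_homog f_nozero
    (fun t => @regular_sequence_free _ _ _ f t f_regular).
have homL (a : 'I_m.+1 -> R[i]) : linear_form a \is 1.-homog.
  by apply: rpred_sum => i _; apply: rpredZ; rewrite dhomogX /= mdeg1.
pose U := [set z : rquot f |
  exists2 a, delta.@[a] != 0 & z = \pi_(rquot f) (linear_form a)].
(* As [d > 1], distinct linear forms have distinct classes. *)
have UE a : U (\pi_(rquot f) (linear_form a)) <-> delta.@[a] != 0.
  split=> [[b nz_db /pi_rquot_eq ab]|]; last by exists a.
  have homLab : linear_form a - linear_form b \is 1.-homog.
    by apply: rpredB; apply: homL.
  have /eqP := ideal_gen_low_degree f_homog hd homLab ab.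
  rewrite subr_eq0 => /eqP Lab.
  rewrite (@meval_eq _ _ _ b) // => i.
  by rewrite -[a i]dot_delta -[b i]dot_delta -!meval_linear_form Lab.
exists U; split.
- split=> [_ [a _ ->]|]; first by exists (linear_form a) => //; exact: homL.
  exists [set delta]; apply/seteqP; split=> a /=.
    by move=> Ua _ ->; apply/eqP; apply: contra_notT Ua => /UE.
  by move=> da0 /UE; rewrite da0 ?eqxx.
- have [a nz_da] := exists_nonroot nz_delta.
  by exists (\pi_(rquot f) (linear_form a)); apply/UE.
move=> _ [a nz_da ->] _ _ /set_mem[p homp <-] /set_mem[q homq <-].
move=> Lpq; have {Lpq} : \pi_(rquot f) (linear_form a * p) =
    \pi_(rquot f) (linear_form a * q) by rewrite !pi_rquot_mul.
move=> /pi_rquot_eq; rewrite -mulrBr => Lpq.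
have hompq : p - q \is d.-1.-homog by rewrite rpredB.
have homLpq : linear_form a * (p - q) \is d.-homog.
  by have := dhomogM (homL a) hompq; rewrite add1n (ltn_predK hd).
have [t LE] := ideal_gen_dhomog f_homog homLpq Lpq.
congr (\pi_(rquot f) _); apply/eqP; rewrite -subr_eq0.
apply/eqP; apply: inj_delta nz_da _ _ _ LE.
apply/msize_leP => v; apply: contraNT; rewrite -leqNgt => le_dv.
apply/eqP; apply: (dhomog_nemf_coeff hompq).
by rewrite neq_ltn orbC (leq_trans _ le_dv) // ltn_predL ltnW.
Qed.
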